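(* Let $m,n$ be positive integers, $Q=(q_{ij})$ a real $m\times n$ matrix, $c\in\mathbb{R}^m$ and $d\in\mathbb{R}^n$ row vectors, and let $$\mathcal{G}=\{(x,y) : x\in\{0,1\}^m,\ y\in\{0,1\}^n,\ f(x,y)\le \mathcal{A}(Q,c,d)\}.$$ Then $|\mathcal{G}|\ge 2^{m+n-2}$.
   Context: For data $(Q,c,d)$ of the bipartite boolean quadratic programming problem (BBQP), the objective function (to be maximized) is $f(x,y)=x^TQy+cx+dy$ for $x\in\{0,1\}^m$, $y\in\{0,1\}^n$. The average value of all solutions is $\mathcal{A}(Q,c,d)=2^{-(m+n)}\sum_{(x,y)\in\{0,1\}^m\times\{0,1\}^n}f(x,y)$. *)

(* Defs.v *)
From mathcomp Require Import all_boot all_order all_algebra.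
From mathcomp Require Import reals.

Set Implicit Arguments.
Unset Strict Implicit.
Unset Printing Implicit Defensive.

Import Order.TTheory GRing.Theory Num.Theory.
Local Open Scope ring_scope.

(* Points of {0,1}^k are boolean column vectors (a finType); [bits] embeds
   them into R^k. *)
Definition bits (R : realType) (k : nat) (x : 'cV[bool]_k) : 'cV[R]_k :=
  \col_i (x i 0)%:R.

(* The sum is a 1 x 1 matrix; [0 0] reads off its unique entry. *)
Definition bbqp_obj (R : realType) (m n : nat) (Q : 'M[R]_(m, n))
    (c : 'rV[R]_m) (d : 'rV[R]_n)
    (x : 'cV[bool]_m) (y : 'cV[bool]_n) : R :=
  ((bits R x)^T *m Q *m bits R y + c *m bits R x + d *m bits R y) 0 0.

Definition bbqp_avg (R : realType) (m n : nat) (Q : 'M[R]_(m, n))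
    (c : 'rV[R]_m) (d : 'rV[R]_n) : R :=
  2 ^- (m + n) *
    \sum_(p : 'cV[bool]_m * 'cV[bool]_n) bbqp_obj Q c d p.1 p.2.

(* Main.v *)
Require Import Defs.
From mathcomp Require Import all_boot all_order all_algebra.
From mathcomp Require Import reals.
From mathcomp Require Import ring lra.

Set Implicit Arguments.
Unset Strict Implicit.
Unset Printing Implicit Defensive.

Import Order.TTheory GRing.Theory Num.Theory.
Local Open Scope ring_scope.

(** Complementing all the bits of [x], of [y], or of both, is an action of the
    Klein four-group on the solutions. Since [f] is affine in [x] for fixed [y]
    and conversely, averaging [f] over the four points of an orbit amounts to
    evaluating its bilinear extension at the centre of the cube, where all
    coordinates are [1/2]. The orbit average thus does not depend on the orbit
    ([sum_obj_complements]), so it is the global average [A]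
    ([sum_obj_complements_avg]), and every orbit contains a solution of value
    at most [A]. Hence the four images of [G] under the group cover all
    [2 ^ (m + n)] solutions; as each image has [#|G|] elements,
    [2 ^ (m + n) <= 4 * #|G|]. *)

Definition complement (k : nat) (x : 'cV[bool]_k) : 'cV[bool]_k :=
  map_mx negb x.

Lemma complementK (k : nat) : involutive (@complement k).
Proof. by move=> x; apply/matrixP=> i j; rewrite !mxE negbK. Qed.

Lemma bits_complement (R : realType) (k : nat) (x : 'cV[bool]_k) :
  bits R (complement x) = const_mx 1 - bits R x.
Proof.
by apply/matrixP=> i j; rewrite !mxE; case: (x i 0); rewrite ?subrr ?subr0.
Qed.

(** The right-hand side is four times the value of the bilinear extension of
    the objective at the centre of the cube. *)
Lemma sum_obj_complements (R : realType) (m n : nat) (Q : 'M[R]_(m, n))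
    (c : 'rV[R]_m) (d : 'rV[R]_n) (x : 'cV[bool]_m) (y : 'cV[bool]_n) :
  bbqp_obj Q c d x y + bbqp_obj Q c d (complement x) y +
  (bbqp_obj Q c d x (complement y) +
   bbqp_obj Q c d (complement x) (complement y)) =
  ((const_mx 1 : 'cV_m)^T *m Q *m (const_mx 1 : 'cV_n)
   + (c *m const_mx 1) *+ 2 + (d *m const_mx 1) *+ 2) 0 0.
Proof.
rewrite /bbqp_obj !bits_complement.
move: (bits R x) (bits R y) => u v.
move: (const_mx 1 : 'cV_m) (const_mx 1 : 'cV_n) => e e'.
rewrite !linearB /= !(mulmxBl, mulmxBr).
(* The products become atoms, so that taking entries stops at them. *)
move: (u^T *m Q *m v) (e^T *m Q *m v) (u^T *m Q *m e') (e^T *m Q *m e').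
move: (c *m u) (c *m e) (d *m v) (d *m e') => cu ce dv de uv ev ue ee.
rewrite !mulr2n !mxE; ring.
Qed.

Definition complement_fst (m n : nat) (p : 'cV[bool]_m * 'cV[bool]_n) :=
  (complement p.1, p.2).

Definition complement_snd (m n : nat) (p : 'cV[bool]_m * 'cV[bool]_n) :=
  (p.1, complement p.2).

Lemma complement_fstK (m n : nat) : involutive (@complement_fst m n).
Proof. by case=> x y; rewrite /complement_fst /= complementK. Qed.

Lemma complement_sndK (m n : nat) : involutive (@complement_snd m n).
Proof. by case=> x y; rewrite /complement_snd /= complementK. Qed.

Lemma card_solutions (m n : nat) :
  #|{: 'cV[bool]_m * 'cV[bool]_n}| = (2 ^ (m + n))%N.
Proof. by rewrite card_prod !card_mx card_bool !muln1 expnD. Qed.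

(** Summing over all [p] the four values on the orbit of [p] counts every
    solution four times, so the common orbit sum has to be four times the
    average. *)
Lemma sum_obj_complements_avg (R : realType) (m n : nat) (Q : 'M[R]_(m, n))
    (c : 'rV[R]_m) (d : 'rV[R]_n) (x : 'cV[bool]_m) (y : 'cV[bool]_n) :
  bbqp_obj Q c d x y + bbqp_obj Q c d (complement x) y +
  (bbqp_obj Q c d x (complement y) +
   bbqp_obj Q c d (complement x) (complement y)) = 4 * bbqp_avg Q c d.
Proof.
pose f (p : 'cV[bool]_m * 'cV[bool]_n) := bbqp_obj Q c d p.1 p.2.
rewrite sum_obj_complements; set K := (X in X = _).
have sum_fst g : \sum_p g (@complement_fst m n p) = \sum_p g p :> R.
  by rewrite [RHS](reindex_inj (inv_inj (@complement_fstK m n))).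
have sum_snd g : \sum_p g (@complement_snd m n p) = \sum_p g p :> R.
  by rewrite [RHS](reindex_inj (inv_inj (@complement_sndK m n))).
have sum_orbits : \sum_p (f p + f (complement_fst p) +
    (f (complement_snd p) + f (complement_fst (complement_snd p))))
    = 2 ^+ (m + n) * K.
  under eq_bigr => p _ do rewrite /f sum_obj_complements.
  by rewrite sumr_const card_solutions -natrX mulr_natl.
move: sum_orbits.
rewrite !big_split /= (sum_snd f) (sum_snd (f \o @complement_fst m n)) sum_fst.
have pow2_neq0 : 2 ^+ (m + n) != 0 :> R by rewrite expf_neq0 // pnatr_eq0.
move=> sum_orbits; apply: (mulfI pow2_neq0); rewrite -sum_orbits /bbqp_avg -/f.
by field.
Qed.

Theorem theorem3 (R : realType) (m n : nat) (hm : (0 < m)%N) (hn : (0 < n)%N)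
    (Q : 'M[R]_(m, n)) (c : 'rV[R]_m) (d : 'rV[R]_n) :
  (2 ^ (m + n - 2) <=
     #|[set p : 'cV[bool]_m * 'cV[bool]_n |
          (bbqp_obj Q c d p.1 p.2 <= bbqp_avg Q c d)%R]|)%N.
Proof.
set G := [set p | _].
pose G1 := G :|: @complement_fst m n @: G.
have cover : [set: 'cV[bool]_m * 'cV[bool]_n]
    \subset G1 :|: @complement_snd m n @: G1.
  apply/subsetP=> -[x y] _.
  have mem_fst q : (complement_fst q \in G) -> q \in G1.
    by move=> Gq; rewrite inE -[q]complement_fstK imset_f ?orbT.
  have mem_snd q : (complement_snd q \in G1) ->
      q \in @complement_snd m n @: G1.
    by move=> Gq; rewrite -[q]complement_sndK imset_f.
  rewrite inE; apply/orP.
  have orbit_sum := sum_obj_complements_avg Q c d x y.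
  case: (leP (bbqp_obj Q c d x y) (bbqp_avg Q c d)) => [le00|gt00].
    by left; rewrite inE inE le00.
  case: (leP (bbqp_obj Q c d (complement x) y) (bbqp_avg Q c d))
    => [le10|gt10].
    by left; apply: mem_fst; rewrite inE.
  case: (leP (bbqp_obj Q c d x (complement y)) (bbqp_avg Q c d))
    => [le01|gt01].
    by right; apply: mem_snd; rewrite inE inE le01.
  right; apply/mem_snd/mem_fst; rewrite inE /=; lra.
have card_double (T : finType) (h : T -> T) (A : {set T}) :
    (#|A :|: h @: A| <= 2 * #|A|)%N.
  rewrite mul2n -addnn (leq_trans (leq_card_setU _ _)) //.
  by rewrite leq_add2l leq_imset_card.
have card4 : (2 ^ (m + n) <= 4 * #|G|)%N.
  rewrite -card_solutions -cardsT (leq_trans (subset_leq_card cover)) //.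
  rewrite (leq_trans (card_double _ _ _)) //.
  by rewrite -[4%N]/(2 * 2)%N -mulnA leq_mul2l card_double.
by rewrite -(leq_pmul2l (isT : 0 < 4)%N) -(expnD 2 2) subnKC // (leq_add hm hn).
Qed.
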